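(* Let $a<b$ be real numbers and let $f\in C^2([a,b])$ be real-valued. Define $E^M(f)$ by $$\int_a^b f(x)\,dx=(b-a)\,f\!\left(\frac{a+b}{2}\right)+E^M(f).$$ Then $$|E^M(f)|\leq \frac{(b-a)^3\|f''\|_\infty}{24}.$$ Moreover (composite midpoint rule), for every natural number $n\ge 1$, setting $y_i=a+(b-a)(2i-1)/(2n)$ for $1\leq i\leq n$ and defining $E^M_n(f)$ by $$\int_a^b f(x)\,dx=\frac{b-a}{n}\sum_{i=1}^n f(y_i)+E^M_n(f),$$ one has $$|E^M_n(f)|\leq\frac{(b-a)^3\|f''\|_\infty}{24n^2}.$$
   Context: $C^2([a,b])$ denotes the functions on $[a,b]$ that are continuous together with their derivatives up to order $2$ on $[a,b]$ (one-sided derivatives at the endpoints). $\|g\|_\infty=\sup_{x\in[a,b]}|g(x)|$ is the uniform norm on $[a,b]$. The point $y_i$ is the midpoint of $[x_{i-1},x_i]$, where $x_i=a+(b-a)i/n$ for $0\leq i\leq n$. *)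

(* Defs.v *)
From Stdlib Require Import Reals Lra.
From Coquelicot Require Import Coquelicot.
Open Scope R_scope.

Definition Icc (a b x : R) : Prop := a <= x <= b.

(* The difference quotient only sees points of [a,b], so this is the two-sided
   derivative at interior points and the one-sided derivative at a and at b;
   the values of [f] outside [a,b] are irrelevant. *)
Definition is_derive_on (a b : R) (f : R -> R) (x l : R) : Prop :=
  filterlim (fun y => (f y - f x) / (y - x))
            (within (Icc a b) (locally' x)) (locally l).

Definition ex_derive_on (a b : R) (f : R -> R) (x : R) : Prop :=
  exists l, is_derive_on a b f x l.

(* Meaningful only for x in [a,b], when [ex_derive_on a b f x]. *)
Definition Derive_on (a b : R) (f : R -> R) (x : R) : R :=
  iota (fun l => is_derive_on a b f x l).

Fixpoint Derive_n_on (a b : R) (f : R -> R) (k : nat) : R -> R :=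
  match k with
  | O => f
  | S k' => Derive_on a b (Derive_n_on a b f k')
  end.

Definition Ck_on (k : nat) (a b : R) (f : R -> R) : Prop :=
  (forall j, (j < k)%nat ->
     forall x, Icc a b x -> ex_derive_on a b (Derive_n_on a b f j) x) /\
  (forall j, (j <= k)%nat -> continuous_on (Icc a b) (Derive_n_on a b f j)).

(* [real] sends an infinite supremum to 0; for [g] continuous on [a,b] with
   a <= b the supremum is finite. *)
Definition sup_norm_on (a b : R) (g : R -> R) : R :=
  real (Lub_Rbar (fun r => exists x, Icc a b x /\ r = Rabs (g x))).

Lemma is_derive_on_unique (a b : R) (f : R -> R) (x l : R) :
  a < b -> Icc a b x -> is_derive_on a b f x l -> Derive_on a b f x = l.
Proof.
intros Hab [Hax Hxb] H.
refine (iota_filterlim_locally (V := R_CompleteNormedModule) _ l H).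
split.
- intros [e He].
  destruct (Rlt_le_dec x b) as [Hb|Hb].
  + apply (He (x + Rmin (e / 2) (b - x))).
    * change (Rabs (x + Rmin (e / 2) (b - x) + - x) < e).
      destruct e as [e e0]; simpl in *.
      unfold Rmin; destruct Rle_dec; rewrite Rabs_pos_eq; lra.
    * destruct e as [e e0]; simpl in *.
      unfold Rmin; destruct Rle_dec; lra.
    * destruct e as [e e0]; simpl in *.
      unfold Icc, Rmin; destruct Rle_dec; lra.
  + apply (He (x - Rmin (e / 2) (x - a))).
    * change (Rabs (x - Rmin (e / 2) (x - a) + - x) < e).
      destruct e as [e e0]; simpl in *.
      unfold Rmin; destruct Rle_dec; rewrite Rabs_left; lra.
    * destruct e as [e e0]; simpl in *.
      unfold Rmin; destruct Rle_dec; lra.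
    * destruct e as [e e0]; simpl in *.
      unfold Icc, Rmin; destruct Rle_dec; lra.
- unfold locally'; apply within_filter, within_filter, locally_filter.
Qed.

(* Main.v *)
Require Import Defs.
From Stdlib Require Import Reals Lra Lia.
From Coquelicot Require Import Coquelicot.
Open Scope R_scope.

(** By Taylor's formula at the midpoint [c] of a panel [[p,q]], the function
    differs from its tangent line at [c] by at most [M (x - c)^2 / 2], where [M]
    bounds the absolute value of the second derivative ([taylor_remainder_le]).  The linear term
    integrates to zero by symmetry, and the integral of the bound is
    [M (q - p)^3 / 24] ([midpoint_panel_error]).  Adding up [n] panels of width
    [(b - a) / n] gives [n M ((b - a) / n)^3 / 24] ([midpoint_composite_error]);
    the simple rule is the case of one panel.

    The hypotheses on [f] speak of [[a,b]] only, whereas the mean value theorem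
    and the integrability criterion ask for two-sided continuity at the
    endpoints.  The analysis is therefore carried out on the extensions of [f],
    [f'] and [f''] that are constant outside [[a,b]] ([clamp]): these are
    continuous everywhere, and keep the derivatives at interior points, which is
    all that the mean value theorem uses. *)

(** * Midpoint quadrature for a function with bounded second derivative *)

(** The mean value theorem loses the factor 1/2 when applied to the remainder
    itself, so it is applied to [M (t - c)^2 / 2 - s (f t - f c - g c (t - c))]:
    by the mean value inequality for [g], its derivative has the sign of
    [t - c], so it is minimal at [t = c], where it vanishes.  The signs
    [s = 1] and [s = -1] give the two halves of the estimate. *)
Lemma taylor_remainder_le (a b M : R) (f g h : R -> R) (c x : R) :
  (forall t, continuous f t) -> (forall t, continuous g t) ->
  (forall t, a < t < b -> is_derive f t (g t)) ->
  (forall t, a < t < b -> is_derive g t (h t)) ->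
  (forall t, a <= t <= b -> Rabs (h t) <= M) ->
  a <= c <= b -> a <= x <= b ->
  Rabs (f x - f c - g c * (x - c)) <= M * (x - c) ^ 2 / 2.
Proof.
intros Cf Cg Df Dg Hh Hc Hx.
assert (range : forall y t, a <= y <= b ->
          (Rmin c y <= t <= Rmax c y -> a <= t <= b) /\
          (Rmin c y < t < Rmax c y -> a < t < b)).
{ intros y t Hy; unfold Rmin, Rmax; destruct Rle_dec; split; lra. }
assert (Lg : forall y, a <= y <= b -> Rabs (g y - g c) <= M * Rabs (y - c)).
{ intros y Hy.
  destruct (MVT_gen g c y h) as [z [Hz E]].
  - intros t Ht; apply Dg, (range y t Hy), Ht.
  - intros t _; apply continuity_pt_filterlim, Cg.
  - rewrite E, Rabs_mult; apply Rmult_le_compat_r; [apply Rabs_pos|].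
    apply Hh, (range y z Hy), Hz. }
assert (half : forall s, Rabs s = 1 ->
          s * (f x - f c - g c * (x - c)) <= M * (x - c) ^ 2 / 2).
{ intros s Hs.
  pose (u := fun t => M * (t - c) ^ 2 / 2 - s * (f t - f c - g c * (t - c))).
  destruct (MVT_gen u c x (fun t => M * (t - c) - s * (g t - g c)))
    as [z [Hz E]].
  - intros t Ht; apply (range x t Hx), Df in Ht.
    unfold u; auto_derive.
    + repeat split; eexists; apply Ht.
    + replace (Derive (fun y => f y) t) with (g t)
        by (symmetry; apply is_derive_unique, Ht).
      field.
  - intros t _; unfold u; apply continuity_pt_filterlim.
    apply (continuous_minus (V := R_NormedModule)
      (fun t => M * (t - c) ^ 2 / 2) (fun t => s * (f t - f c - g c * (t - c)))).
    + apply (ex_derive_continuous (V := R_NormedModule)); auto_derive; trivial.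
    + apply (continuous_scal_r (V := R_NormedModule) s
               (fun t => f t - f c - g c * (t - c))).
      apply (continuous_minus (V := R_NormedModule)
               (fun t => f t - f c) (fun t => g c * (t - c))).
      * apply (continuous_minus (V := R_NormedModule) f (fun _ => f c));
          [apply Cf | apply continuous_const].
      * apply (ex_derive_continuous (V := R_NormedModule)); auto_derive; trivial.
  - assert (P : 0 <= u x - u c).
    { rewrite E.
      assert (B : Rabs (s * (g z - g c)) <= M * Rabs (z - c)).
      { rewrite Rabs_mult, Hs, Rmult_1_l; apply Lg, (range x z Hx), Hz. }
      apply Rabs_le_between in B; revert Hz B.
      unfold Rmin, Rmax; destruct Rle_dec; intros Hz B.
      - rewrite (Rabs_pos_eq (z - c)) in B by lra; apply Rmult_le_pos; lra.
      - rewrite (Rabs_left1 (z - c)) in B by lra.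
        rewrite <- Rmult_opp_opp; apply Rmult_le_pos; lra. }
    unfold u in P; nra. }
apply Rabs_le; split.
- generalize (half (-1) ltac:(rewrite Rabs_left; lra)); lra.
- generalize (half 1 Rabs_R1); lra.
Qed.

Lemma midpoint_panel_error (a b M : R) (f g h : R -> R) (p q : R) :
  (forall t, continuous f t) -> (forall t, continuous g t) ->
  (forall t, a < t < b -> is_derive f t (g t)) ->
  (forall t, a < t < b -> is_derive g t (h t)) ->
  (forall t, a <= t <= b -> Rabs (h t) <= M) ->
  a <= p -> p <= q -> q <= b ->
  Rabs (RInt f p q - (q - p) * f ((p + q) / 2)) <= M * (q - p) ^ 3 / 24.
Proof.
intros Cf Cg Df Dg Hh Hap Hpq Hqb.
set (c := (p + q) / 2).
assert (poly : forall P P' : R -> R,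
          (forall t, is_derive P t (P' t)) -> (forall t, ex_derive P' t) ->
          is_RInt P' p q (P q - P p)).
{ intros P P' HP HP'; apply (is_RInt_derive P P').
  - intros t _; apply HP.
  - intros t _; apply (ex_derive_continuous (V := R_NormedModule)), HP'. }
assert (If : is_RInt f p q (RInt f p q)).
{ apply (RInt_correct f), (ex_RInt_continuous (V := R_CompleteNormedModule)).
  intros t _; apply Cf. }
assert (Il : is_RInt (fun t => f c + g c * (t - c)) p q ((q - p) * f c)).
{ replace ((q - p) * f c) with
    ((f c * q + g c * (q - c) ^ 2 / 2) - (f c * p + g c * (p - c) ^ 2 / 2))
    by (unfold c; field).
  apply (poly (fun t => f c * t + g c * (t - c) ^ 2 / 2)); intros t;
    auto_derive; trivial; field. }
assert (Iq : is_RInt (fun t => M * (t - c) ^ 2 / 2) p q (M * (q - p) ^ 3 / 24)).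
{ replace (M * (q - p) ^ 3 / 24) with
    (M * (q - c) ^ 3 / 6 - M * (p - c) ^ 3 / 6) by (unfold c; field).
  apply (poly (fun t => M * (t - c) ^ 3 / 6)); intros t;
    auto_derive; trivial; field. }
apply (norm_RInt_le (V := R_NormedModule)
         (fun t => f t - (f c + g c * (t - c))) (fun t => M * (t - c) ^ 2 / 2) p q).
- exact Hpq.
- intros t Ht.
  change (Rabs (f t - (f c + g c * (t - c))) <= M * (t - c) ^ 2 / 2).
  replace (f t - (f c + g c * (t - c))) with (f t - f c - g c * (t - c)) by ring.
  apply (taylor_remainder_le a b M f g h); trivial; unfold c; lra.
- exact (is_RInt_minus (V := R_NormedModule) _ _ _ _ _ _ If Il).
- exact Iq.
Qed.

Lemma midpoint_composite_error (a b M d : R) (f g h : R -> R) (k : nat) :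
  (forall t, continuous f t) -> (forall t, continuous g t) ->
  (forall t, a < t < b -> is_derive f t (g t)) ->
  (forall t, a < t < b -> is_derive g t (h t)) ->
  (forall t, a <= t <= b -> Rabs (h t) <= M) ->
  0 <= d -> a + INR k * d <= b ->
  Rabs (RInt f a (a + INR k * d) -
        d * sum_n_m (fun i => f (a + d * (2 * INR i - 1) / 2)) 1 k)
    <= INR k * (M * d ^ 3 / 24).
Proof.
intros Cf Cg Df Dg Hh Hd.
set (y := fun i => f (a + d * (2 * INR i - 1) / 2)).
induction k as [|k IH]; intros Hk.
- rewrite sum_n_m_zero by lia.
  replace (a + INR 0 * d) with a by (simpl; ring).
  rewrite RInt_point; change (Rabs (0 - d * 0) <= 0 * (M * d ^ 3 / 24)).
  replace (0 - d * 0) with 0 by ring; rewrite Rabs_R0; lra.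
- rewrite S_INR in Hk |- *.
  set (p := a + INR k * d).
  assert (Hp : a <= p).
  { generalize (Rmult_le_pos _ _ (pos_INR k) Hd); unfold p; lra. }
  assert (Eq : a + (INR k + 1) * d = p + d) by (unfold p; ring).
  rewrite Eq in Hk |- *.
  specialize (IH ltac:(fold p; lra)); fold p in IH.
  assert (ex : forall u v, ex_RInt f u v).
  { intros u v; apply (ex_RInt_continuous (V := R_CompleteNormedModule)).
    intros t _; apply Cf. }
  rewrite <- (RInt_Chasles f a p (p + d)) by apply ex.
  rewrite sum_n_Sm by lia.
  assert (Pk := midpoint_panel_error a b M f g h p (p + d) Cf Cg Df Dg Hh Hp
                  ltac:(lra) Hk).
  replace (p + d - p) with d in Pk by ring.
  replace (f ((p + (p + d)) / 2)) with (y (S k)) in Pk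
    by (unfold y, p; rewrite S_INR; f_equal; field).
  change (Rabs (RInt f a p + RInt f p (p + d) - d * (sum_n_m y 1 k + y (S k)))
            <= (INR k + 1) * (M * d ^ 3 / 24)).
  replace (RInt f a p + RInt f p (p + d) - d * (sum_n_m y 1 k + y (S k)))
    with ((RInt f a p - d * sum_n_m y 1 k) + (RInt f p (p + d) - d * y (S k)))
    by ring.
  eapply Rle_trans; [apply Rabs_triang|]; lra.
Qed.

(** * Passage from the interval to the line *)

Definition clamp (a b x : R) : R := Rmax a (Rmin x b).

Lemma clamp_in (a b x : R) : a <= b -> Icc a b (clamp a b x).
Proof.
intros H; unfold Icc, clamp, Rmax, Rmin; repeat destruct Rle_dec; lra.
Qed.

Lemma clamp_id (a b x : R) : Icc a b x -> clamp a b x = x.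
Proof.
unfold Icc, clamp, Rmax, Rmin; intros H; repeat destruct Rle_dec; lra.
Qed.

Lemma clamp_lipschitz (a b x y : R) :
  a <= b -> Rabs (clamp a b y - clamp a b x) <= Rabs (y - x).
Proof.
intros H; unfold clamp, Rmax, Rmin, Rabs.
repeat destruct Rle_dec; repeat destruct Rcase_abs; lra.
Qed.

Lemma continuous_clamp (a b : R) (f : R -> R) (x : R) :
  a <= b -> continuous_on (Icc a b) f ->
  continuous (fun t => f (clamp a b t)) x.
Proof.
intros H Cf.
apply (filterlim_comp _ _ _ (clamp a b) f _
         (within (Icc a b) (locally (clamp a b x)))).
- intros P [e He]; exists e; intros t Ht.
  apply He; [|apply clamp_in, H].
  eapply Rle_lt_trans; [apply clamp_lipschitz, H | exact Ht].
- apply Cf, clamp_in, H.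
Qed.

(** Near an interior point the extension agrees with [f], and the restriction of
    the difference quotient to points of [[a,b]] has no effect. *)
Lemma is_derive_clamp (a b : R) (f : R -> R) (x l : R) :
  a < x < b -> is_derive_on a b f x l ->
  is_derive (fun t => f (clamp a b t)) x l.
Proof.
intros Hx D.
assert (near : locally x (fun t => Icc a b t)).
{ apply (filter_imp (fun t => a < t /\ t < b)).
  - intros t; unfold Icc; lra.
  - apply filter_and; [apply open_gt | apply open_lt]; lra. }
apply (is_derive_ext_loc f).
- revert near; apply filter_imp; intros t Ht; rewrite clamp_id; trivial.
- apply is_derive_Reals; intros e He.
  assert (Q : locally x (fun y => y <> x -> Icc a b y ->
                           ball l e ((f y - f x) / (y - x))))
    by exact (D _ (locally_ball l (mkposreal e He))).
  destruct (filter_and _ _ Q near) as [d Hd].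
  exists d; intros k Hk Hkd.
  destruct (Hd (x + k)) as [H1 H2].
  + change (Rabs (x + k - x) < d).
    replace (x + k - x) with k by ring; exact Hkd.
  + assert (B := H1 ltac:(lra) H2).
    change (Rabs ((f (x + k) - f x) / (x + k - x) - l) < e) in B.
    replace (x + k - x) with k in B by ring; exact B.
Qed.

(** [real] sends an infinite supremum to 0, so the bound needs the supremum to be
    finite: by continuity, [Rabs g] attains a maximum on [[a,b]]. *)
Lemma Rabs_le_sup_norm_on (a b : R) (g : R -> R) (x : R) :
  a <= b -> continuous_on (Icc a b) g -> Icc a b x ->
  Rabs (g x) <= sup_norm_on a b g.
Proof.
intros H Cg Hx.
destruct (continuity_ab_maj (fun t => Rabs (g (clamp a b t))) a b H)
  as [m [Hm _]].
{ intros t _; apply continuity_pt_filterlim.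
  apply (continuous_comp (fun t => g (clamp a b t)) Rabs).
  - apply continuous_clamp; assumption.
  - apply continuous_Rabs. }
unfold sup_norm_on.
set (E := fun r => exists x, Icc a b x /\ r = Rabs (g x)).
destruct (Lub_Rbar_correct E) as [Hub Hlub].
assert (U : Rbar_le (Lub_Rbar E) (Rabs (g (clamp a b m)))).
{ apply Hlub; intros r [t [Ht ->]].
  generalize (Hm t Ht); rewrite (clamp_id a b t Ht); trivial. }
assert (L : Rbar_le (Rabs (g x)) (Lub_Rbar E)) by (apply Hub; exists x; auto).
destruct (Lub_Rbar E) as [r| |]; simpl in *; tauto.
Qed.

Lemma is_derive_on_Derive_on (a b : R) (f : R -> R) (x : R) :
  a < b -> Icc a b x -> ex_derive_on a b f x ->
  is_derive_on a b f x (Derive_on a b f x).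
Proof.
intros H Hx [l Hl].
rewrite (is_derive_on_unique a b f x l H Hx Hl); exact Hl.
Qed.

(** * The midpoint rule *)

Lemma midpoint_rule_error (a b : R) (f : R -> R) (n : nat) :
  a < b -> Ck_on 2 a b f -> (1 <= n)%nat ->
  Rabs (RInt f a b -
        (b - a) / INR n *
          sum_n_m (fun i => f (a + (b - a) * (2 * INR i - 1) / (2 * INR n))) 1 n)
    <= (b - a) ^ 3 * sup_norm_on a b (Derive_n_on a b f 2) / (24 * INR n ^ 2).
Proof.
intros Hab [D C] Hn.
set (ext := fun j t => Derive_n_on a b f j (clamp a b t)).
assert (Cext : forall j, (j <= 2)%nat -> forall t, continuous (ext j) t).
{ intros j Hj t; apply continuous_clamp; [lra | apply C, Hj]. }
assert (Dext : forall j, (j < 2)%nat -> forall t, a < t < b ->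
          is_derive (ext j) t (ext (S j) t)).
{ intros j Hj t Ht; assert (It : Icc a b t) by (unfold Icc; lra).
  apply is_derive_clamp; [exact Ht|]; unfold ext; rewrite (clamp_id a b t It).
  apply is_derive_on_Derive_on; auto. }
assert (n0 : 0 < INR n) by (apply lt_0_INR; lia).
set (M := sup_norm_on a b (Derive_n_on a b f 2)).
set (d := (b - a) / INR n).
assert (Hd : 0 <= d) by (apply Rlt_le, Rdiv_lt_0_compat; lra).
assert (End : a + INR n * d = b) by (unfold d; field; lra).
assert (K := midpoint_composite_error a b M d (ext 0%nat) (ext 1%nat) (ext 2%nat) n
          (Cext 0%nat ltac:(lia)) (Cext 1%nat ltac:(lia))
          (Dext 0%nat ltac:(lia)) (Dext 1%nat ltac:(lia))).
rewrite End in K.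
replace ((b - a) ^ 3 * M / (24 * INR n ^ 2)) with (INR n * (M * d ^ 3 / 24))
  by (unfold d; field; lra).
replace (RInt f a b) with (RInt (ext 0%nat) a b).
2: { apply RInt_ext; intros t; rewrite Rmin_left, Rmax_right by lra; intros Ht.
     unfold ext; rewrite clamp_id; [reflexivity | unfold Icc; lra]. }
rewrite (sum_n_m_ext_loc _ (fun i => ext 0%nat (a + d * (2 * INR i - 1) / 2))).
- apply K; [|exact Hd|lra].
  intros t _; unfold ext; apply Rabs_le_sup_norm_on;
    [lra | apply C; lia | apply clamp_in; lra].
- intros i [Hi1 Hi2]; apply le_INR in Hi1, Hi2; simpl in Hi1.
  unfold ext; simpl.
  replace (a + (b - a) * (2 * INR i - 1) / (2 * INR n))
    with (a + d * (2 * INR i - 1) / 2) by (unfold d; field; lra).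
  rewrite clamp_id; [reflexivity|].
  assert (L := Rmult_le_pos d (2 * INR i - 1) Hd ltac:(lra)).
  assert (U := Rmult_le_pos d (INR n - INR i) Hd ltac:(lra)).
  unfold Icc; lra.
Qed.

Theorem mainTheorem1 :
  forall (a b : R) (f : R -> R),
  a < b -> Ck_on 2 a b f ->
  (forall E : R,
     RInt f a b = (b - a) * f ((a + b) / 2) + E ->
     Rabs E <= (b - a) ^ 3 * sup_norm_on a b (Derive_n_on a b f 2) / 24) /\
  (forall (n : nat) (E : R), (1 <= n)%nat ->
     RInt f a b =
       (b - a) / INR n *
         sum_n_m (fun i => f (a + (b - a) * (2 * INR i - 1) / (2 * INR n))) 1 n
       + E ->
     Rabs E <=
       (b - a) ^ 3 * sup_norm_on a b (Derive_n_on a b f 2) / (24 * INR n ^ 2)).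
Proof.
intros a b f Hab Hf; split.
- intros E HE.
  assert (K := midpoint_rule_error a b f 1 Hab Hf (le_n 1)).
  rewrite sum_n_n, HE in K; change (INR 1) with 1 in K.
  replace (a + (b - a) * (2 * 1 - 1) / (2 * 1)) with ((a + b) / 2) in K by field.
  replace E with
    ((b - a) * f ((a + b) / 2) + E - (b - a) / 1 * f ((a + b) / 2)) by field.
  replace (24 * 1 ^ 2) with 24 in K by ring.
  exact K.
- intros n E Hn HE.
  assert (K := midpoint_rule_error a b f n Hab Hf Hn).
  rewrite HE in K.
  match type of K with Rabs (?s + E - ?s) <= _ =>
    replace (s + E - s) with E in K by ring end.
  exact K.
Qed.
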